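(* Let $m,n\ge1$ be integers, $A=(a_{ij})$ an $n\times m$ real matrix and $q_{\max}>1$. Let $\gamma$ be such that every $m$-tuple $q_1,\dots,q_m$ returned by the ILLL-algorithm on input $A,q_{\max}$ satisfies $q^{\frac{m}{n}}\max_i\|q_1a_{i1}+\dots+q_ma_{im}\|>\gamma$, where $q=\max_j|q_j|$. Put $$\delta=2^{-\frac{(m+n)(m^2+m(3n-1)+4n+2n^2)}{4n^2}}\,m^{-\frac{m}{2n}}\,n^{-\frac12}\,\gamma^{\frac{m+n}{n}}.$$ Then every $m$-tuple of integers $s_1,\dots,s_m$ with $s=\max_j|s_j|$ and $$2^{\frac{(m+n-1)n}{4m}}\left(\frac{n\delta^2}{m}\right)^{\frac{n}{2(m+n)}}<s<2^{-\frac{m^2+m(n-1)+4n}{4m}}\left(\frac{n\delta^2}{m}\right)^{\frac{n}{2(m+n)}}q_{\max}$$ satisfies $s^{\frac{m}{n}}\max_i\|s_1a_{i1}+\dots+s_ma_{im}\|>\delta$.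
   Context: $\|x\|$ denotes the distance from $x\in\mathbb R$ to the nearest integer. A basis $b_1,\dots,b_r$ of $\mathbb R^r$ with Gram–Schmidt vectors $b_i^*=b_i-\sum_{j<i}\mu_{ij}b_j^*$, $\mu_{ij}=(b_i,b_j^* )/(b_j^*,b_j^* )$, is reduced if $|\mu_{ij}|\le\frac12$ ($j<i$) and $|b_i^*+\mu_{i,i-1}b_{i-1}^*|^2\ge\frac34|b_{i-1}^*|^2$ ($1<i\le r$); the LLL-algorithm returns a reduced basis of the lattice generated by its input basis. The ILLL-algorithm on input $A$ and $q_{\max}>1$: put $k'=\left\lceil -\frac{(m+n-1)(m+n)}{4n}+\frac{m\log_2 q_{\max}}{n}\right\rceil$ and, for $k\ge1$, $c(k)=\left(2^{-\frac{m+n+3}{4}-k+1}\right)^{\frac{m+n}{m}}$. Start with the basis given by the columns of $B=\begin{pmatrix} I_n & A\\ 0& c(1)I_m\end{pmatrix}$. In iteration $k=1,\dots,k'$: apply the LLL-algorithm to the current basis; from the first vector of the reduced basis, which has the form $(q_1a_{11}+\dots+q_ma_{1m}-p_1,\dots,q_1a_{n1}+\dots+q_ma_{nm}-p_n,c(k)q_1,\dots,c(k)q_m)^T$ with $p_i,q_j\in\mathbb Z$, output the $m$-tuple $q(k)=(q_1,\dots,q_m)$; then divide the last $m$ coordinates of all basis vectors by $2^{\frac{m+n}{m}}$. The $m$-tuples returned are $q(1),\dots,q(k')$. *)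

(* Defs.v *)
From HB Require Import structures.
From mathcomp Require Import all_boot all_order all_algebra.
From mathcomp Require Import reals exp.
Set Implicit Arguments. Unset Strict Implicit. Unset Printing Implicit Defensive.
Import Order.TTheory GRing.Theory Num.Theory.
Local Open Scope ring_scope.

Section Defs.
Variable R : realType.

Definition dist_int (x : R) : R :=
  Num.min (x - (Num.floor x)%:~R) ((Num.ceil x)%:~R - x).

Definition dot (r : nat) (u v : 'cV[R]_r) : R := \sum_(k < r) u k 0 * v k 0.

Definition bcol (r : nat) (B : 'M[R]_r) (k : nat) : 'cV[R]_r :=
  if @insub _ (fun i => (i < r)%N) 'I_r k is Some j then col j B else 0.

Definition gs_mu (r : nat) (x y : 'cV[R]_r) : R := dot x y / dot y y.

Fixpoint gs_seq (r : nat) (b : nat -> 'cV[R]_r) (k : nat) : seq 'cV[R]_r :=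
  match k with
  | 0 => [::]
  | k'.+1 =>
      let s := gs_seq b k' in
      rcons s (b k' - \sum_(j < k') gs_mu (b k') (nth 0 s j) *: nth 0 s j)
  end.

Definition bstar (r : nat) (B : 'M[R]_r) (i : nat) : 'cV[R]_r :=
  nth 0 (gs_seq (bcol B) i.+1) i.

Definition mu (r : nat) (B : 'M[R]_r) (i j : nat) : R :=
  gs_mu (bcol B i) (bstar B j).

Definition reduced (r : nat) (B : 'M[R]_r) : Prop :=
  (forall i j : nat, (j < i)%N -> (i < r)%N -> `|mu B i j| <= 1/2) /\
  (forall i : nat, (0 < i)%N -> (i < r)%N ->
     let v := bstar B i + mu B i i.-1 *: bstar B i.-1 in
     dot v v >= 3/4 * dot (bstar B i.-1) (bstar B i.-1)).

Definition same_lattice (r : nat) (B B' : 'M[R]_r) : Prop :=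
  (exists U : 'M[int]_r, B' = B *m map_mx (fun z : int => z%:~R) U) /\
  (exists V : 'M[int]_r, B = B' *m map_mx (fun z : int => z%:~R) V).

Definition kprime (m n : nat) (qmax : R) : int :=
  Num.ceil (- (((m + n)%:R - 1) * (m + n)%:R) / (4 * n%:R)
            + m%:R * (ln qmax / ln 2) / n%:R).

Definition cILLL (m n k : nat) : R :=
  (2 `^ (- (((m + n)%:R + 3) / 4) - k%:R + 1)) `^ ((m + n)%:R / m%:R).

Definition B0 (m n : nat) (A : 'M[R]_(n, m)) : 'M[R]_(n + m) :=
  block_mx 1%:M A 0 (cILLL m n 1)%:M.

Definition Dscale (m n : nat) : 'M[R]_(n + m) :=
  block_mx 1%:M 0 0 ((2 `^ ((m + n)%:R / m%:R))^-1)%:M.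

(* Bs k is the reduced basis produced by the LLL call in iteration k,
   for k = 1, ..., k'. *)
Definition ILLL_run (m n : nat) (A : 'M[R]_(n, m)) (qmax : R)
    (Bs : nat -> 'M[R]_(n + m)) : Prop :=
  forall k : nat, (1 <= k)%N -> k%:Z <= kprime m n qmax ->
    reduced (Bs k) /\
    same_lattice (if k == 1%N then B0 A else Dscale m n *m Bs k.-1) (Bs k).

Definition ILLL_out (m n : nat) (Bs : nat -> 'M[R]_(n + m)) (k : nat)
  : 'I_m -> R :=
  fun j => bcol (Bs k) 0 (rshift n j) 0 / cILLL m n k.

Definition supnorm (m : nat) (q : 'I_m -> R) : R :=
  \big[Num.max/0]_(j < m) `|q j|.

Definition approx_err (m n : nat) (A : 'M[R]_(n, m)) (q : 'I_m -> R) : R :=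
  \big[Num.max/0]_(i < n) dist_int (\sum_(j < m) q j * A i j).

Definition deltaILLL (m n : nat) (gamma : R) : R :=
  2 `^ (- (((m + n)%:R * ((m ^ 2)%:R + m%:R * (3 * n%:R - 1)
                          + 4 * n%:R + 2 * (n ^ 2)%:R))
          / (4 * (n ^ 2)%:R)))
  * m%:R `^ (- (m%:R / (2 * n%:R)))
  * n%:R `^ (- (1 / 2))
  * gamma `^ ((m + n)%:R / n%:R).

End Defs.

(* Main.v *)
(* Write r = m + n, c = c(k), and let b be the first vector of the reduced basis
   of iteration k.  That basis spans the lattice generated by the columns of
   [[I, A], [0, c I]], of determinant c^m.  Hence |b|^r <= 2^(r(r-1)/4) c^m, and
   |b|^2 <= 2^(r-1) |x|^2 for every nonzero lattice vector x.  The output q(k)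
   satisfies q <= |b| / c, with approximation error at most |b|, so that
   gamma < (|b| / c)^(m/n) |b|.

   A tuple s violating the conclusion has error at most delta s^(-m/n); it gives
   a lattice vector x with |x|^2 <= n delta^2 s^(-2m/n) + m c^2 s^2.  The two terms
   are equal when c is c* = (n delta^2 / m)^(1/2) s^(-r/n).  Let k be the first index
   with c(k) <= c*.  The lower bound on s gives k >= 1, and the upper bound gives
   k <= k'.  Since c* < 2^(r/m) c(k), the short vector bound yields
   gamma < 2^(r(r+2)/(2n)) n^(1/2) m^(m/(2n)) delta, whereas the determinant bound
   gives gamma < 2^(r(r-1)/(4n)), i.e. gamma^(m/n) < 2^(r(r-1)m/(4n^2)).  The
   definition of delta makes these two inequalities incompatible. *)
Require Import Defs.
From HB Require Import structures.
From mathcomp Require Import all_boot all_order all_algebra.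
From mathcomp Require Import reals exp.
From mathcomp Require Import sequences ring lra.
Import Order.TTheory GRing.Theory Num.Theory.
Local Open Scope ring_scope.

Set Implicit Arguments.
Unset Strict Implicit.

(** * Gram-Schmidt orthogonalization and reduced bases *)

Section GramSchmidt.
Variables (R : realType) (r : nat).
Implicit Types (u v w : 'cV[R]_r) (B : 'M[R]_r).

Lemma dotC u v : dot u v = dot v u.
Proof. by apply: eq_bigr => k _; rewrite mulrC. Qed.

Lemma dotDl u v w : dot (u + v) w = dot u w + dot v w.
Proof. by rewrite -big_split; apply: eq_bigr => k _; rewrite mxE mulrDl. Qed.

Lemma dotZl a u v : dot (a *: u) v = a * dot u v.
Proof. by rewrite mulr_sumr; apply: eq_bigr => k _; rewrite mxE mulrA. Qed.

Lemma dotBl u v w : dot (u - v) w = dot u w - dot v w.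
Proof. by rewrite dotDl -scaleN1r dotZl mulN1r. Qed.

Lemma dot0l v : dot 0 v = 0.
Proof. by rewrite -(scale0r v) dotZl mul0r. Qed.

Lemma dot_suml (I : Type) (s : seq I) (P : pred I) (f : I -> 'cV[R]_r) v :
  dot (\sum_(i <- s | P i) f i) v = \sum_(i <- s | P i) dot (f i) v.
Proof.
elim/big_rec2: _ => [|i y x _ <-]; first exact: dot0l.
by rewrite dotDl.
Qed.

Lemma dot_ge0 u : 0 <= dot u u.
Proof. by apply: sumr_ge0 => k _; rewrite -expr2 sqr_ge0. Qed.

Lemma dot_eq0 u : dot u u = 0 -> u = 0.
Proof.
move=> /eqP; rewrite psumr_eq0 => [/allP u0|k _]; last by rewrite -expr2 sqr_ge0.
apply/colP => k; rewrite mxE; apply/eqP.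
by have := u0 k (mem_index_enum k); rewrite /= -expr2 sqrf_eq0.
Qed.

Lemma dot_orthD u v : dot u v = 0 -> dot (u + v) (u + v) = dot u u + dot v v.
Proof.
by move=> uv; rewrite !(dotDl, dotC _ (u + v)) uv (dotC v u) uv addr0 add0r.
Qed.

(** The case v = 0 is included: every product with v vanishes there, whatever the value of the
    quotient. *)
Lemma gs_mu_proj u v : dot (u - gs_mu u v *: v) v = 0.
Proof.
rewrite dotBl dotZl /gs_mu; have [/dot_eq0 ->|v0] := eqVneq (dot v v) 0.
  by rewrite (dotC _ 0) !dot0l mulr0 subr0.
by rewrite divfK ?subrr.
Qed.

Lemma size_gs_seq (b : nat -> 'cV[R]_r) k : size (gs_seq b k) = k.
Proof. by elim: k => //= k IH; rewrite size_rcons IH. Qed.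

Lemma nth_gs_seq (b : nat -> 'cV[R]_r) k j :
  (j < k)%N -> nth 0 (gs_seq b k) j = nth 0 (gs_seq b j.+1) j.
Proof.
elim: k => // k IH; rewrite ltnS leq_eqVlt => /orP[/eqP -> //|jk].
by rewrite [gs_seq b k.+1]/= nth_rcons size_gs_seq jk IH.
Qed.

Lemma bstarE B i :
  bstar B i = bcol B i - \sum_(j < i) mu B i j *: bstar B j.
Proof.
rewrite {1}/bstar /= nth_rcons size_gs_seq ltnn eqxx; congr (_ - _).
by apply: eq_bigr => j _; rewrite nth_gs_seq.
Qed.

Lemma bcolE B i :
  bcol B i = bstar B i + \sum_(j < i) mu B i j *: bstar B j.
Proof. by rewrite bstarE subrK. Qed.

Lemma bcol_ord B (i : 'I_r) : bcol B i = col i B.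
Proof. by rewrite /bcol valK. Qed.

(** Strong induction on i: the j-th term of the sum removes the component of b_i along b*_j, and the
    other terms are orthogonal to b*_j by induction. *)
Lemma bstar_orth_lt B i j : (j < i)%N -> dot (bstar B i) (bstar B j) = 0.
Proof.
elim/ltn_ind: i j => i IH j ji; rewrite bstarE.
rewrite (bigD1 (Ordinal ji)) //= opprD addrA dotBl gs_mu_proj sub0r dot_suml.
rewrite big1 ?oppr0 // => k; rewrite -val_eqE /= => kj; rewrite dotZl.
have [jk|/ltnW kj'|kj'] := ltngtP j k; last by rewrite kj' eqxx in kj.
  by rewrite IH ?mulr0.
by rewrite dotC IH ?mulr0 // ltn_neqAle kj.
Qed.

Lemma bstar_orth B i j : i != j -> dot (bstar B i) (bstar B j) = 0.
Proof.
by case: ltngtP => // ij _; [rewrite dotC|]; exact: bstar_orth_lt.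
Qed.

Lemma dot_bcol_bstar_lt B i j : (i < j)%N -> dot (bcol B i) (bstar B j) = 0.
Proof.
move=> ij; rewrite bcolE dotDl dot_suml bstar_orth ?ltn_eqF // add0r big1 //.
by move=> k _; rewrite dotZl bstar_orth ?mulr0 // ltn_eqF // (ltn_trans _ ij).
Qed.

Lemma dot_bcol_bstar B i : dot (bcol B i) (bstar B i) = dot (bstar B i) (bstar B i).
Proof.
rewrite {1}bcolE dotDl dot_suml big1 ?addr0 // => k _.
by rewrite dotZl bstar_orth ?mulr0 // ltn_eqF.
Qed.

(** By orthogonality the Lovasz condition reads |b*_{i+1}|^2 + mu^2 |b*_i|^2 >= 3/4 |b*_i|^2, and
    mu^2 <= 1/4 leaves the factor 1/2. *)
Lemma reduced_bstar B i : reduced B -> (i.+1 < r)%N ->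
  dot (bstar B i) (bstar B i) <= 2 * dot (bstar B i.+1) (bstar B i.+1).
Proof.
move=> [mu_le lovasz] ir; have := lovasz i.+1 isT ir => /=.
rewrite dot_orthD; last first.
  by rewrite dotC dotZl bstar_orth ?mulr0 // ltn_eqF.
rewrite dotZl (dotC _ (_ *: _)) dotZl => lov.
have mu2 : mu B i.+1 i ^+ 2 <= 1 / 4.
  rewrite -real_normK ?num_real //.
  have := mu_le i.+1 i (ltnSn i) ir; have := normr_ge0 (mu B i.+1 i); nra.
have := dot_ge0 (bstar B i); nra.
Qed.

Lemma reduced_first B i : reduced B -> (i < r)%N ->
  dot (bcol B 0) (bcol B 0) <= 2 ^+ i * dot (bstar B i) (bstar B i).
Proof.
move=> redB; elim: i => [|i IH] ir.
  by rewrite bstarE big_ord0 subr0 mul1r.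
apply: le_trans (IH (ltnW ir)) _.
by rewrite exprSr -mulrA ler_pM2l ?exprn_gt0 // reduced_bstar.
Qed.

(** Gram-Schmidt as a factorization B = S T: the columns of S are the b*_i, so that S^T S is
    diagonal, and T is unit upper triangular. *)
Lemma det_sqr_bstar B :
  \det B ^+ 2 = \prod_(i < r) dot (bstar B i) (bstar B i).
Proof.
pose S : 'M[R]_r := \matrix_(k, i) bstar B i k 0.
pose T : 'M[R]_r := \matrix_(j, i)
  if (j < i)%N then mu B i j else (j == i)%:R.
have BE : B = S *m T.
  apply/matrixP => k i; have /(congr1 (fun v : 'cV_r => v k 0)) := bcolE B i.
  rewrite bcol_ord !mxE summxE => ->.
  rewrite (bigID (fun j : 'I_r => (j < i)%N)) /= addrC; congr (_ + _).
    rewrite (big_ord_widen_cond r xpredT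
      (fun j => (mu B i j *: bstar B j) k 0)) ?(ltnW (ltn_ord i)) //=.
    by apply: eq_bigr => j ji; rewrite !mxE ji mulrC.
  rewrite (bigD1 i) ?ltnn //= !mxE ltnn eqxx mulr1 big1 ?addr0 //.
  by move=> j /andP[/negbTE ji /negbTE ji']; rewrite !mxE ji ji' mulr0.
have detT : \det T = 1.
  rewrite -det_tr det_trig.
    by rewrite big1 // => i _; rewrite !mxE ltnn eqxx.
  apply/is_trig_mxP => i j ij; rewrite !mxE ltnNge (ltnW ij) /=.
  by rewrite -val_eqE /= gtn_eqF.
have StS : S^T *m S = diag_mx (\row_i dot (bstar B i) (bstar B i)).
  apply/matrixP => i j; rewrite !mxE.
  under eq_bigr do rewrite !mxE.
  have [<-|ij] := eqVneq i j; first by rewrite mulr1n.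
  by rewrite mulr0n; exact: bstar_orth.
rewrite {1}BE det_mulmx detT mulr1 expr2 -{1}(det_tr S) -det_mulmx StS det_diag.
by apply: eq_bigr => i _; rewrite mxE.
Qed.

(** The bounds [reduced_first] are multiplied over all i < r; the exponents 0, ..., r-1 add up to
    the binomial coefficient. *)
Lemma reduced_first_det B : reduced B ->
  dot (bcol B 0) (bcol B 0) ^+ r <= 2 ^+ 'C(r, 2) * \det B ^+ 2.
Proof.
move=> redB; rewrite det_sqr_bstar.
rewrite -bin2_sum big_mkord -prodrXr -big_split /=.
rewrite -[X in _ ^+ X]card_ord -prodr_const.
by apply: ler_prod => i _; rewrite dot_ge0 reduced_first.
Qed.

Lemma reduced_first_shortest B (z : 'cV[int]_r) x :
  reduced B -> z != 0 -> x = B *m map_mx (fun a : int => a%:~R) z ->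
  dot (bcol B 0) (bcol B 0) <= 2 ^+ r.-1 * dot x x.
Proof.
move=> redB nz_z x_z.
have [i0 zi0] : exists i, z i 0 != 0.
  apply/existsP; apply: contraNT nz_z => /existsPn z0; apply/eqP/colP => i.
  by rewrite mxE; apply/eqP; have := z0 i; rewrite negbK.
(* x = z_1 b_1 + ... + z_i b_i with z_i a nonzero integer, so that the component
   of x along b*_i is z_i b*_i. *)
case: (@arg_maxnP _ i0 (fun i => z i 0 != 0) val zi0) => i zi imax.
have xE : x = \sum_j (z j 0)%:~R *: bcol B j.
  apply/colP => k; rewrite x_z summxE mxE; apply: eq_bigr => j _.
  by rewrite bcol_ord !mxE mulrC.
have xi : dot x (bstar B i) = (z i 0)%:~R * dot (bstar B i) (bstar B i).
  rewrite xE dot_suml (bigD1 i) //= dotZl dot_bcol_bstar big1 ?addr0 // => j ji.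
  rewrite dotZl; have [->|zj] := eqVneq (z j 0) 0; first by rewrite mul0r.
  rewrite dot_bcol_bstar_lt ?mulr0 // ltn_neqAle; rewrite ji /=.
  exact: imax.
have bx : dot (bstar B i) (bstar B i) <= dot x x.
  pose w := x - (z i 0)%:~R *: bstar B i.
  have -> : x = w + (z i 0)%:~R *: bstar B i by rewrite subrK.
  rewrite dot_orthD; last by rewrite dotC dotZl dotC dotBl dotZl xi subrr mulr0.
  rewrite dotZl (dotC _ (_ *: _)) dotZl mulrA -expr2.
  have z1 : 1 <= ((z i 0)%:~R : R) ^+ 2.
    rewrite -real_normK ?num_real // -intr_norm exprn_ege1 // ler1z.
    by rewrite -gtz0_ge1 normr_gt0.
  have := dot_ge0 w; have := dot_ge0 (bstar B i); nra.
apply: le_trans (reduced_first redB (ltn_ord i)) _.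
apply: ler_pM; rewrite ?exprn_ge0 ?dot_ge0 //.
rewrite ler_weXn2l ?ler1n //.
by have := ltn_ord i; case: (r) (i) => // r' i'.
Qed.

End GramSchmidt.

(** * Change of lattice basis *)

Section Lattices.
Variables (R : realType) (r : nat).
Implicit Types L B D : 'M[R]_r.

Lemma same_lattice_trans L B D :
  same_lattice L B -> same_lattice B D -> same_lattice L D.
Proof.
move=> [[U1 BL] [V1 LB]] [[U2 DB] [V2 BD]]; split.
  by exists (U1 *m U2); rewrite map_mxM mulmxA -BL.
by exists (V2 *m V1); rewrite map_mxM mulmxA -BD.
Qed.

Lemma same_lattice_mull D L B :
  same_lattice L B -> same_lattice (D *m L) (D *m B).
Proof.
by move=> [[U BL] [V LB]]; split; [exists U|exists V]; rewrite -mulmxA -?BL -?LB.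
Qed.

(** The integer matrix V with L = B V has nonzero determinant, hence det(V)^2 >= 1. *)
Lemma same_lattice_det L B :
  same_lattice L B -> \det L != 0 -> \det B ^+ 2 <= \det L ^+ 2.
Proof.
move=> [_ [V ->]]; rewrite det_mulmx det_map_mx mulf_eq0 negb_or => /andP[_].
rewrite intr_eq0 => V0; rewrite exprMn ler_peMr ?sqr_ge0 //.
rewrite -real_normK ?num_real // -intr_norm exprn_ege1 // ler1z.
by rewrite -gtz0_ge1 normr_gt0.
Qed.

End Lattices.

(** * Distance to the nearest integer and maximum norms *)

Section Norms.
Variable R : realType.

Lemma dist_int_le (x : R) (p : int) : dist_int x <= `|x - p%:~R|.
Proof.
rewrite /dist_int ge_min; have [px|xp] := leP p%:~R x; apply/orP.
  left; rewrite ger0_norm ?subr_ge0 // lerD2l lerN2 ler_int.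
  by rewrite floor_ge_int.
right; rewrite ltr0_norm ?subr_lt0 // opprB lerD2r ler_int.
by rewrite ceil_le_int // ltW.
Qed.

Lemma dist_int_attained (x : R) : exists p : int, dist_int x = `|x - p%:~R|.
Proof.
rewrite /dist_int; case: leP => _.
  by exists (Num.floor x); rewrite ger0_norm // subr_ge0 floor_le.
by exists (Num.ceil x); rewrite ler0_norm ?opprB // subr_le0 ceil_ge.
Qed.

Lemma entry_le_sqrt_dot r (u : 'cV[R]_r) i : `|u i 0| <= Num.sqrt (dot u u).
Proof.
rewrite -sqrtr_sqr ler_wsqrtr // /dot (bigD1 i) //= expr2 lerDl.
by apply: sumr_ge0 => k _; rewrite -expr2 sqr_ge0.
Qed.

Lemma supnorm_ge0 m (q : 'I_m -> R) : 0 <= supnorm q.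
Proof. by apply: (big_ind (fun x => 0 <= x)) => // x y; rewrite le_max => ->. Qed.

Lemma le_supnorm m (q : 'I_m -> R) j : `|q j| <= supnorm q.
Proof. exact: le_bigmax. Qed.

Lemma dist_le_approx_err m n (A : 'M[R]_(n, m)) q i :
  dist_int (\sum_(j < m) q j * A i j) <= approx_err A q.
Proof. exact: (le_bigmax _ (fun i => dist_int (\sum_(j < m) q j * A i j))). Qed.

Lemma approx_err_ge0 m n (A : 'M[R]_(n, m)) q : 0 <= approx_err A q.
Proof.
apply: (big_ind (fun x => 0 <= x)) => // [x y|i _]; first by rewrite le_max => ->.
by have [p ->] := dist_int_attained (\sum_(j < m) q j * A i j).
Qed.

End Norms.

(** * The lattice of iteration k and its first reduced vector *)

Section ILLL.
Variables (R : realType) (m n : nat) (A : 'M[R]_(n, m)).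
Hypotheses (m_gt0 : (0 < m)%N) (n_gt0 : (0 < n)%N).
Implicit Types (k : nat) (q : 'I_m -> R).
Local Notation c := (cILLL R m n).

(** An explicit basis of the lattice treated in iteration k; for k = 1 it is the input basis
    [B0 A]. *)
Definition ILLL_basis k : 'M[R]_(n + m) := block_mx 1%:M A 0 (c k)%:M.

Lemma cILLL_gt0 k : 0 < c k.
Proof. by rewrite !powR_gt0. Qed.

Lemma ln_cILLL k :
  ln (c k) = (m + n)%:R / m%:R * ((- (((m + n)%:R + 3) / 4) - k%:R + 1) * ln 2).
Proof. by rewrite !ln_powR. Qed.

Lemma cILLLS k : c k.+1 = (2 `^ ((m + n)%:R / m%:R))^-1 * c k.
Proof.
have m0 : m%:R != 0 :> R by rewrite pnatr_eq0 -lt0n.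
rewrite /cILLL -!powRrM -powRN -powRD; last by rewrite pnatr_eq0 implybT.
by congr powR; rewrite -natr1; field.
Qed.

Lemma Dscale_ILLL_basis k : Dscale R m n *m ILLL_basis k = ILLL_basis k.+1.
Proof.
rewrite mulmx_block !mul1mx !mul0mx !mulmx0 !addr0 !add0r.
by rewrite -scalar_mxM -cILLLS.
Qed.

Lemma det_ILLL_basis k : \det (ILLL_basis k) = c k ^+ m.
Proof. by rewrite det_ublock det1 mul1r det_scalar. Qed.

Section Iteration.
Variables (B : 'M[R]_(n + m)) (k : nat).
Hypotheses (redB : reduced B) (latB : same_lattice (ILLL_basis k) B).
Let N2 := dot (bcol B 0) (bcol B 0).
Let q (j : 'I_m) := bcol B 0 (rshift n j) 0 / c k.

Lemma ILLL_first_det : N2 ^+ (m + n) <= 2 ^+ 'C(m + n, 2) * (c k ^+ m) ^+ 2.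
Proof.
rewrite addnC; apply: le_trans (reduced_first_det redB) _.
rewrite ler_pM2l ?exprn_gt0 // -det_ILLL_basis same_lattice_det //.
by rewrite det_ILLL_basis expf_neq0 // gt_eqF ?cILLL_gt0.
Qed.

Lemma ILLL_supnorm : supnorm q <= Num.sqrt N2 / c k.
Proof.
apply: bigmax_le => [|j _]; first by rewrite divr_ge0 ?sqrtr_ge0 ?ltW ?cILLL_gt0.
rewrite normrM normfV (gtr0_norm (cILLL_gt0 k)).
by rewrite ler_wpM2r ?invr_ge0 ?entry_le_sqrt_dot ?ltW ?cILLL_gt0.
Qed.

(** The first vector b is an integer combination of the columns of [ILLL_basis k]. Its lower part
    identifies the q_j with integer coefficients; each upper coordinate then differs from sum_j q_j
    a_ij by an integer, so it bounds the distance to the nearest integer. *)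
Lemma ILLL_approx_err : approx_err A q <= Num.sqrt N2.
Proof.
have nm : (0 < n + m)%N by rewrite addn_gt0 n_gt0.
have [[U BU] _] := latB; pose i0 := Ordinal nm.
have c0 := cILLL_gt0 k.
have b0E : bcol B 0 = ILLL_basis k *m map_mx intr (col i0 U).
  by rewrite (bcol_ord B i0) BU map_col !colE mulmxA.
have qE j : q j = (U (rshift n j) i0)%:~R.
  rewrite /q b0E -[map_mx _ _]vsubmxK mul_block_col col_mxEd mul0mx add0r.
  by rewrite mul_scalar_mx !mxE mulrC mulKf ?gt_eqF.
apply: bigmax_le => [|i _]; first exact: sqrtr_ge0.
apply: le_trans (dist_int_le _ (- U (lshift m i) i0)) _.
apply: le_trans (entry_le_sqrt_dot (bcol B 0) (lshift m i)).
rewrite b0E -[map_mx _ _]vsubmxK mul_block_col col_mxEu mul1mx.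
rewrite !mxE mulrNz opprK addrC.
under eq_bigr do rewrite qE mulrC.
by under [in leRHS]eq_bigr do rewrite !mxE.
Qed.

(** The comparison vector x has upper coordinates sum_j s_j a_ij - p_i, with p_i a nearest integer,
    and lower coordinates c(k) s_j. *)
Lemma ILLL_first_short (s : 'I_m -> int) (t : 'I_m -> R := fun j => (s j)%:~R) :
  0 < supnorm t ->
  N2 <= 2 ^+ (m + n).-1 *
        (n%:R * approx_err A t ^+ 2 + m%:R * (c k * supnorm t) ^+ 2).
Proof.
move=> t_gt0; have c0 := cILLL_gt0 k.
have /boolp.choice [p pE] i :
    exists p : int, dist_int (\sum_(j < m) t j * A i j)
                  = `|\sum_(j < m) t j * A i j - p%:~R|.
  exact: dist_int_attained.
pose y : 'cV[int]_(n + m) := col_mx (\col_i - p i) (\col_j s j).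
pose x := ILLL_basis k *m map_mx intr y.
have xE : x = col_mx (\col_i (\sum_(j < m) t j * A i j - (p i)%:~R))
                     (\col_j (c k * t j)).
  rewrite /x /y map_col_mx mul_block_col mul0mx mul1mx add0r mul_scalar_mx.
  congr col_mx; apply/colP => i; rewrite !mxE //.
  rewrite mulrNz addrC; congr (_ - _); apply: eq_bigr => j _.
  by rewrite !mxE mulrC.
have [_ [V LV]] := latB.
(* [V *m y] holds the coordinates of x in the basis B. If it were 0, then x = 0, and the lower
   coordinates c(k) s_j would force s = 0. *)
have nz : V *m y != 0.
  apply/eqP => Vy0; have x0 : x = 0.
    by rewrite /x LV -mulmxA -map_mxM Vy0 map_mx0 mulmx0.
  move: t_gt0; suff -> : supnorm t = 0 by rewrite ltxx.
  apply/eqP; rewrite eq_le supnorm_ge0 andbT; apply: bigmax_le => // j _.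
  have := congr1 (fun v : 'cV_(n + m) => v (rshift n j) 0) x0.
  rewrite xE col_mxEd !mxE => /eqP; rewrite mulf_eq0 gt_eqF //= => /eqP ->.
  by rewrite normr0.
have xB : x = B *m map_mx (fun a : int => a%:~R) (V *m y).
  by rewrite map_mxM mulmxA -LV.
apply: le_trans (reduced_first_shortest redB nz xB) _.
rewrite (addnC m) ler_pM2l ?exprn_gt0 // xE /dot big_split_ord /=; apply: lerD.
  rewrite mulr_natl -[X in _ *+ X]card_ord -sumr_const; apply: ler_sum => i _.
  rewrite col_mxEu !mxE -expr2 -real_normK ?num_real // -pE lerXn2r ?nnegrE //.
  - by rewrite pE.
  - exact: approx_err_ge0.
  - exact: dist_le_approx_err.
rewrite mulr_natl -[X in _ *+ X]card_ord -sumr_const; apply: ler_sum => j _.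
rewrite col_mxEd !mxE -expr2 -real_normK ?num_real // lerXn2r ?nnegrE //.
  by rewrite mulr_ge0 ?supnorm_ge0 ?ltW.
by rewrite normrM gtr0_norm // ler_pM2l // le_supnorm.
Qed.

End Iteration.

(** Reduction keeps the lattice, and the rescaling between iterations takes the lattice of iteration
    k to that of k + 1. *)
Lemma ILLL_run_lattice qmax Bs k : ILLL_run A qmax Bs ->
  (1 <= k)%N -> k%:Z <= kprime m n qmax -> same_lattice (ILLL_basis k) (Bs k).
Proof.
move=> run; elim: k => // -[_ _|k IH _] kk'; first by have [_] := run 1%N isT kk'.
have [_] := run k.+2 isT kk'; apply: same_lattice_trans.
rewrite -Dscale_ILLL_basis; apply: same_lattice_mull; apply: IH => //.
by apply: le_trans kk'; rewrite lez_nat.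
Qed.

End ILLL.

(** * Arithmetic of the logarithmic estimates *)

Section Estimates.
Variable R : realType.

(* The variables stand for the logarithms of 2, m, n, s, delta, gamma, |b|^2 and
   c(k).  The weights in g1, ..., g4 are those for which the combination of the
   four estimates vanishes after substituting the value of ld. *)
Lemma log_estimates_inconsistent (m n r l2 lm ln_ ls ld lg lN lc : R) :
  0 < m -> 0 < n -> r = m + n ->
  ld = - ((r * (m ^+ 2 + m * (3 * n - 1) + 4 * n + 2 * n ^+ 2)) / (4 * n ^+ 2)) * l2
       - m / (2 * n) * lm - ln_ / 2 + r / n * lg ->
  lg < m / n * (lN / 2 - lc) + lN / 2 ->
  r * lN <= r * (r - 1) / 2 * l2 + 2 * m * lc ->
  lN <= r * l2 + (ln_ + 2 * ld - 2 * (m / n) * ls) ->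
  (ln_ - lm) / 2 + ld - r / n * ls < lc + r / m * l2 ->
  False.
Proof.
move=> m0 n0 rE ldE h1 h2 h3 h4; have [m0' n0'] : m != 0 /\ n != 0.
  by rewrite !gt_eqF.
have r0 : 0 < r by rewrite rE addr_gt0.
have g1 : 0 < (m / n * (lN / 2 - lc) + lN / 2 - lg) * (1 + m / n).
  by rewrite mulr_gt0 ?subr_gt0 ?addr_gt0 ?divr_gt0.
have g2 : 0 <= (r * (r - 1) / 2 * l2 + 2 * m * lc - r * lN) * (m / (2 * n ^+ 2)).
  by apply: mulr_ge0; rewrite ?subr_ge0 // ltW // divr_gt0 ?mulr_gt0 ?exprn_gt0.
have g3 : 0 <= (r * l2 + (ln_ + 2 * ld - 2 * (m / n) * ls) - lN) * (r / (2 * n)).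
  by apply: mulr_ge0; rewrite ?subr_ge0 // ltW // divr_gt0 ?mulr_gt0.
have g4 : 0 < (lc + r / m * l2 - ((ln_ - lm) / 2 + ld - r / n * ls)) * (m / n).
  by rewrite mulr_gt0 ?subr_gt0 ?divr_gt0.
move: (addr_gt0 (ltr_wpDr g2 g1) (ltr_wpDl g3 g4)); rewrite lt_neqAle => /andP[/eqP + _].
apply; rewrite ldE rE; clear - m0' n0'; field.
by rewrite n0'.
Qed.

Lemma natr_bin2 k : ('C(k, 2))%:R = k%:R * (k%:R - 1) / 2 :> R.
Proof.
elim: k => [|k IH]; first by rewrite !mul0r.
by rewrite binS bin1 natrD IH -natr1; field.
Qed.

End Estimates.

(** * Logarithmic bounds for the first reduced vector *)

Section FirstVectorLogs.
Variables (R : realType) (m n k : nat) (A : 'M[R]_(n, m)).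
Variables (B : 'M[R]_(n + m)) (gamma : R).
Hypotheses (m_gt0 : (0 < m)%N) (n_gt0 : (0 < n)%N) (gamma_gt0 : 0 < gamma).
Hypotheses (redB : reduced B) (latB : same_lattice (ILLL_basis A k) B).
Let N2 := dot (bcol B 0) (bcol B 0).
Let q (j : 'I_m) := bcol B 0 (rshift n j) 0 / cILLL R m n k.
Hypothesis gamma_lt : gamma < supnorm q `^ (m%:R / n%:R) * approx_err A q.

Let gamma_lt_norm :
  gamma < (Num.sqrt N2 / cILLL R m n k) `^ (m%:R / n%:R) * Num.sqrt N2.
Proof.
apply: lt_le_trans gamma_lt _; apply: ler_pM; rewrite ?powR_ge0 ?approx_err_ge0 //.
  rewrite ge0_ler_powR ?nnegrE ?divr_ge0 ?supnorm_ge0 ?sqrtr_ge0 //.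
    by rewrite ltW ?cILLL_gt0.
  exact: ILLL_supnorm.
exact: ILLL_approx_err.
Qed.

(** If b were zero, the bound on gamma would read gamma < 0. Positivity is what allows taking the
    logarithm of [N2]. *)
Lemma first_vector_gt0 : 0 < N2.
Proof.
rewrite -sqrtr_gt0 lt_neqAle sqrtr_ge0 andbT eq_sym; apply/eqP => N0.
by have := lt_trans gamma_gt0 gamma_lt_norm; rewrite N0 mulr0 ltxx.
Qed.

Lemma ln_gamma_lt :
  ln gamma < m%:R / n%:R * (ln N2 / 2 - ln (cILLL R m n k)) + ln N2 / 2.
Proof.
have N0 := first_vector_gt0; have c0 := @cILLL_gt0 R m n k.
have lnsN : ln (Num.sqrt N2) = ln N2 / 2.
  by rewrite -powR12_sqrt ?ltW // ln_powR mulrC.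
move: gamma_lt_norm; rewrite -ltr_ln ?posrE //; last first.
  by rewrite mulr_gt0 ?powR_gt0 ?divr_gt0 ?sqrtr_gt0.
rewrite lnM ?posrE ?powR_gt0 ?divr_gt0 ?sqrtr_gt0 // ln_powR.
by rewrite ln_div ?posrE ?sqrtr_gt0 // lnsN.
Qed.

Lemma ln_first_vector_det :
  (m + n)%:R * ln N2 <=
  (m + n)%:R * ((m + n)%:R - 1) / 2 * ln 2 + 2 * m%:R * ln (cILLL R m n k).
Proof.
have N0 := first_vector_gt0; have c0 := @cILLL_gt0 R m n k.
have := ILLL_first_det redB latB.
rewrite -ler_ln ?posrE ?mulr_gt0 ?exprn_gt0 //.
rewrite lnM ?posrE ?exprn_gt0 // !lnXn ?exprn_gt0 //.
rewrite -!(mulr_natl (ln _)) natr_bin2 => /le_trans; apply.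
by rewrite lerD2l -mulrnAl -(mulr_natl m%:R).
Qed.

(** The hypothesis on ln c(k) says c(k) <= c*. Then both terms of the bound on |x|^2 are at most n
    delta^2 s^(-2m/n), and their sum costs a factor 2, which turns 2^(r-1) into 2^r. *)
Lemma ln_first_vector_short (s : 'I_m -> int) (t : 'I_m -> R := fun j => (s j)%:~R)
    (delta : R) :
  0 < delta -> 0 < supnorm t ->
  supnorm t `^ (m%:R / n%:R) * approx_err A t <= delta ->
  ln (cILLL R m n k) <=
    (ln n%:R - ln m%:R) / 2 + ln delta - (m + n)%:R / n%:R * ln (supnorm t) ->
  ln N2 <= (m + n)%:R * ln 2
           + (ln n%:R + 2 * ln delta - 2 * (m%:R / n%:R) * ln (supnorm t)).
Proof.
move=> d0 t0 errt lnc; have N0 := first_vector_gt0; have c0 := @cILLL_gt0 R m n k.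
have nR0 : 0 < n%:R :> R by rewrite ltr0n.
have mR0 : 0 < m%:R :> R by rewrite ltr0n.
(* The logarithm of n delta^2 s^(-2m/n). *)
pose Y := ln n%:R + 2 * ln delta - 2 * (m%:R / n%:R) * ln (supnorm t).
have err_le : approx_err A t <= delta * supnorm t `^ (- (m%:R / n%:R)).
  by rewrite powRN ler_pdivlMr ?powR_gt0 // mulrC.
have leY1 : n%:R * approx_err A t ^+ 2 <= expR Y.
  apply: (@le_trans _ _ (n%:R * (delta * supnorm t `^ (- (m%:R / n%:R))) ^+ 2)).
    by rewrite ler_pM2l // lerXn2r ?nnegrE ?approx_err_ge0 ?(mulr_ge0 (ltW d0)) ?powR_ge0.
  have p0 : 0 < delta * supnorm t `^ (- (m%:R / n%:R)) by rewrite mulr_gt0 ?powR_gt0.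
  rewrite -ler_ln ?posrE ?mulr_gt0 ?exprn_gt0 ?expR_gt0 ?powR_gt0 // expRK.
  rewrite lnM ?posrE ?exprn_gt0 // lnXn // lnM ?posrE ?powR_gt0 // ln_powR /Y.
  by lra.
have leY2 : m%:R * (cILLL R m n k * supnorm t) ^+ 2 <= expR Y.
  rewrite -ler_ln ?posrE ?mulr_gt0 ?exprn_gt0 ?mulr_gt0 ?expR_gt0 // expRK.
  rewrite lnM ?posrE ?exprn_gt0 ?mulr_gt0 // lnXn ?mulr_gt0 // lnM ?posrE //.
  have rnE : (m + n)%:R / n%:R = m%:R / n%:R + 1 :> R.
    by rewrite natrD mulrDl divff ?gt_eqF.
  by move: lnc; rewrite rnE /Y; lra.
have := ILLL_first_short redB latB t0; rewrite -/N2 => N2le.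
have : N2 <= 2 ^+ (m + n) * expR Y.
  apply: le_trans N2le _.
  have -> : 2 ^+ (m + n) = 2 ^+ (m + n).-1 * 2 :> R.
    by rewrite -exprSr prednK // addn_gt0 m_gt0.
  rewrite -mulrA ler_pM2l ?exprn_gt0 //.
  by rewrite (mulr_natl (expR Y)) mulr2n lerD.
rewrite -ler_ln ?posrE ?mulr_gt0 ?exprn_gt0 ?expR_gt0 //.
by rewrite lnM ?posrE ?exprn_gt0 ?expR_gt0 // expRK lnXn // mulr_natl.
Qed.

End FirstVectorLogs.

(** * Choice of the iteration and conclusion *)

Unset Implicit Arguments.

Theorem theorem3 (R : realType) (m n : nat) (A : 'M[R]_(n, m))
    (qmax gamma : R) (Bs : nat -> 'M[R]_(n + m)) :
  (1 <= m)%N -> (1 <= n)%N -> 1 < qmax -> 0 < gamma ->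
  ILLL_run A qmax Bs ->
  (forall k : nat, (1 <= k)%N -> k%:Z <= kprime m n qmax ->
     supnorm (ILLL_out Bs k) `^ (m%:R / n%:R)
       * approx_err A (ILLL_out Bs k) > gamma) ->
  forall s : 'I_m -> int,
    let sR := supnorm (fun j => (s j)%:~R : R) in
    let delta := deltaILLL m n gamma in
    let F := (n%:R * delta ^+ 2 / m%:R) `^ (n%:R / (2 * (m + n)%:R)) in
    2 `^ (((m + n)%:R - 1) * n%:R / (4 * m%:R)) * F < sR ->
    sR < 2 `^ (- (((m ^ 2)%:R + m%:R * (n%:R - 1) + 4 * n%:R) / (4 * m%:R)))
           * F * qmax ->
    sR `^ (m%:R / n%:R) * approx_err A (fun j => (s j)%:~R) > delta.
Proof.
move=> m_gt0 n_gt0 q1 gamma0 run out s sR delta F lo hi.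
rewrite ltNge; apply/negP => errs.
have mR0 : 0 < m%:R :> R by rewrite ltr0n.
have nR0 : 0 < n%:R :> R by rewrite ltr0n.
have m0 : m%:R != 0 :> R by rewrite gt_eqF.
have n0 : n%:R != 0 :> R by rewrite gt_eqF.
have rE : (m + n)%:R = m%:R + n%:R :> R by rewrite natrD.
have rR0 : 0 < m%:R + n%:R :> R by rewrite addr_gt0.
have r0 : m%:R + n%:R != 0 :> R by rewrite gt_eqF.
have l20 : 0 < ln 2 :> R by rewrite ln_gt0 // ltr1n.
have delta0 : 0 < delta by rewrite /delta /deltaILLL !mulr_gt0 ?powR_gt0.
have ln_delta : ln delta =
    - (((m%:R + n%:R) * (m%:R ^+ 2 + m%:R * (3 * n%:R - 1) + 4 * n%:R
       + 2 * n%:R ^+ 2)) / (4 * n%:R ^+ 2)) * ln 2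
    - m%:R / (2 * n%:R) * ln m%:R - ln n%:R / 2 + (m%:R + n%:R) / n%:R * ln gamma.
  rewrite /delta /deltaILLL !lnM ?posrE ?mulr_gt0 ?powR_gt0 // !ln_powR rE !natrX.
  by field; rewrite ?n0.
clearbody delta.
have F0 : 0 < F by rewrite /F powR_gt0 // divr_gt0 // mulr_gt0 // exprn_gt0.
have ln_F : ln F = n%:R / (2 * (m%:R + n%:R)) * (ln n%:R + 2 * ln delta - ln m%:R).
  rewrite /F ln_powR rE ln_div ?posrE ?mulr_gt0 ?exprn_gt0 //.
  by rewrite lnM ?posrE ?exprn_gt0 // lnXn // (mulr_natl (ln delta)).
clearbody F.
have s0 : 0 < sR by apply: (lt_trans _ lo); rewrite mulr_gt0 ?powR_gt0.
have ln_lo : (m%:R + n%:R - 1) * n%:R / (4 * m%:R) * ln 2 + ln F < ln sR.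
  move: lo; rewrite -ltr_ln ?posrE ?mulr_gt0 ?powR_gt0 //.
  by rewrite lnM ?posrE ?powR_gt0 // ln_powR rE.
have ln_hi : ln sR < - ((m%:R ^+ 2 + m%:R * (n%:R - 1) + 4 * n%:R) / (4 * m%:R))
    * ln 2 + ln F + ln qmax.
  have q0 : 0 < qmax by apply: (lt_trans _ q1).
  move: hi; rewrite -ltr_ln ?posrE ?mulr_gt0 ?powR_gt0 //.
  by rewrite !lnM ?posrE ?mulr_gt0 ?powR_gt0 // ln_powR natrX.
pose lcd := (ln n%:R - ln m%:R) / 2 + ln delta - (m%:R + n%:R) / n%:R * ln sR.
(* c(k) <= c* if and only if t <= k, where lcd = ln c*. *)
pose t := - ((m%:R + n%:R - 1) / 4) - m%:R / (m%:R + n%:R) * lcd / ln 2.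
(* t is a positive multiple of the gap in the lower bound on ln s. *)
have t0 : 0 < t.
  have -> : t = (m%:R / n%:R / ln 2) *
     (ln sR - ((m%:R + n%:R - 1) * n%:R / (4 * m%:R) * ln 2 + ln F)).
    by rewrite ln_F /t /lcd; field; rewrite m0 n0 r0 gt_eqF.
  by rewrite mulr_gt0 ?subr_gt0 ?divr_gt0.
(* The right-hand side is the number whose ceiling is k'. Its difference from t is 1 plus a positive
   multiple of the gap in the upper bound on ln s. *)
have tk' : t <= - ((m%:R + n%:R - 1) * (m%:R + n%:R)) / (4 * n%:R)
            + m%:R * (ln qmax / ln 2) / n%:R.
  rewrite -subr_ge0; set u := (X in 0 <= X).
  have -> : u = (m%:R / n%:R / ln 2) *
     (- ((m%:R ^+ 2 + m%:R * (n%:R - 1) + 4 * n%:R) / (4 * m%:R)) * ln 2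
       + ln F + ln qmax - ln sR) + 1.
    by rewrite ln_F /u /t /lcd; field; rewrite m0 n0 r0 gt_eqF.
  by rewrite addr_ge0 // mulr_ge0 ?subr_ge0 // ltW // !divr_gt0.
have ct0 : 0 < Num.ceil t by rewrite ceil_gt0.
have ct_le : Num.ceil t <= kprime m n qmax.
  by rewrite ceil_le_int /kprime rE (le_trans tk') // ceil_ge.
(* The iteration used is k = ceil(t); negative integers are excluded by its positivity. *)
case: (Num.ceil t) ct0 ct_le (ceil_itv t) => // k k0 kk' /andP[tk_lo tk_hi].
have redB := (run k k0 kk').1.
have latB := ILLL_run_lattice m_gt0 run k0 kk'.
have gamma_lt := out k k0 kk'.
(* As 0 <= k - t < 1, this gives c(k) <= c* < 2^(r/m) c(k) in logarithmic form. *)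
have ln_cE : ln (cILLL R m n k) =
    lcd - (m%:R + n%:R) / m%:R * ln 2 * (k%:~R - t).
  by rewrite ln_cILLL rE /t; field; rewrite m0 r0 gt_eqF.
have rm0 : 0 < (m%:R + n%:R) / m%:R * ln 2 :> R by rewrite mulr_gt0 // divr_gt0.
apply: (@log_estimates_inconsistent R m%:R n%:R (m + n)%:R (ln 2) (ln m%:R) (ln n%:R)
  (ln sR) (ln delta) (ln gamma) (ln (dot (bcol (Bs k) 0) (bcol (Bs k) 0)))
  (ln (cILLL R m n k)) mR0 nR0 rE).
- by rewrite ln_delta rE.
- exact: ln_gamma_lt gamma_lt.
- exact: ln_first_vector_det gamma_lt.
- apply: (ln_first_vector_short _ _ _ _ _ gamma_lt) => //.
  by rewrite rE ln_cE lerBlDr lerDl mulr_ge0 ?subr_ge0 // ltW.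
- rewrite rE ln_cE -/lcd -addrA ltrDl addrC -{1}[_ * ln 2]mulr1 -mulrBr.
  by rewrite mulr_gt0 // subr_gt0 ltrBlDr -ltrBlDl -[1]/(1%:~R) -intrB.
Qed.
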